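(* Let $p\ge1$ be an integer, let $\alpha\in[0,1)$, and let $F(z)=\sum_{k=1}^{p}|z|^{2(k-1)}\big(h_k(z)+\overline{g_k(z)}\big)\in H_p^0$ be univalent in $\mathbb{U}$. Then $F$ is starlike of order $\alpha$ if and only if $$\sum_{k=1}^{p}|z|^{2(k-1)}\left\{h_k(z)\ast\left[\frac{z+\frac{\alpha\xi+\alpha+\xi-1}{2-\alpha-\alpha\xi}\,z^{2}}{(1-z)^{2}}\right]-\overline{g_k(z)}\ast\left[\frac{\frac{2\xi+\alpha+\alpha\xi}{2-\alpha-\alpha\xi}\,\overline{z}-\frac{\alpha\xi+\alpha+\xi-1}{2-\alpha-\alpha\xi}\,\overline{z}^{2}}{(1-\overline{z})^{2}}\right]\right\}\neq0$$ for all $z\in\mathbb{U}$ with $z\ne0$ and all $\xi\in\mathbb{C}$ with $|\xi|=1$.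
   Context: $\mathbb{U}=\{z\in\mathbb{C}:|z|<1\}$. A $2p$ times continuously differentiable complex-valued mapping $F$ is polyharmonic (or $p$-harmonic) if $\Delta^pF=0$, where $\Delta=4\,\partial^2/\partial z\,\partial\overline z$. $H_p$ is the set of all polyharmonic mappings $F$ in $\mathbb{U}$ with a series expansion of the form $$F(z)=\sum_{k=1}^{p}|z|^{2(k-1)}\big(h_k(z)+\overline{g_k(z)}\big)=\sum_{k=1}^{p}|z|^{2(k-1)}\sum_{j=1}^{\infty}\left(a_{k,j}z^{j}+\overline{b_{k,j}}\,\overline{z}^{\,j}\right),$$ where $h_k(z)=\sum_{j\ge1}a_{k,j}z^j$ and $g_k(z)=\sum_{j\ge1}b_{k,j}z^j$ are analytic in $\mathbb{U}$, $a_{1,1}=1$ and $|b_{1,1}|<1$. $H_p^0$ is the subclass of $H_p$ with $b_{1,1}=0$ and $a_{k,1}=b_{k,1}=0$ for $k\in\{2,\dots,p\}$. The symbol $\ast$ is the convolution (Hadamard product): $\sum_j a_jz^j\ast\sum_j c_jz^j=\sum_j a_jc_jz^j$, and likewise $\sum_j \overline{b_j}\,\overline z^{\,j}\ast\sum_j d_j\overline z^{\,j}=\sum_j \overline{b_j}\,d_j\,\overline z^{\,j}$ for series in $\overline z$. A univalent (injective) polyharmonic mapping $F$ with $F(0)=0$ is starlike of order $\alpha\in[0,1)$ (with respect to the origin) if $$\frac{\partial}{\partial\theta}\big(\arg F(re^{i\theta})\big)=\operatorname{Re}\left\{\frac{zF_z(z)-\overline zF_{\overline z}(z)}{F(z)}\right\}>\alpha$$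 for all $z=re^{i\theta}\ne0$ in $\mathbb{U}$. *)

(* Defs.v *)
(* Stdlib reals and Coquelicot's complex numbers. *)
From Stdlib Require Import Reals ClassicalEpsilon.
From Coquelicot Require Import Coquelicot.
Open Scope C_scope.

Definition unit_disc (z : C) : Prop := (Cmod z < 1)%R.

Definition univalent (F : C -> C) : Prop :=
  forall z w, unit_disc z -> unit_disc w -> F z = F w -> z = w.

(* A point of [C] is the pair (x, y) of its real coordinates; the derivatives
   of a complex-valued map are taken on its real and imaginary parts. *)
Definition partial_x (F : C -> C) (z : C) : C :=
  (Derive (fun t : R => Re (F (t, Im z))) (Re z),
   Derive (fun t : R => Im (F (t, Im z))) (Re z)).

Definition partial_y (F : C -> C) (z : C) : C :=
  (Derive (fun t : R => Re (F (Re z, t))) (Im z),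
   Derive (fun t : R => Im (F (Re z, t))) (Im z)).

Definition has_partials (F : C -> C) (z : C) : Prop :=
  ex_derive (fun t : R => Re (F (t, Im z))) (Re z) /\
  ex_derive (fun t : R => Im (F (t, Im z))) (Re z) /\
  ex_derive (fun t : R => Re (F (Re z, t))) (Im z) /\
  ex_derive (fun t : R => Im (F (Re z, t))) (Im z).

(* n times continuously differentiable, in the real sense, on the disc *)
Fixpoint C_n (n : nat) (F : C -> C) : Prop :=
  (forall z, unit_disc z -> continuous F z) /\
  match n with
  | O => True
  | S m => (forall z, unit_disc z -> has_partials F z) /\
           C_n m (partial_x F) /\ C_n m (partial_y F)
  end.

Definition d_z (F : C -> C) (z : C) : C := (partial_x F z - Ci * partial_y F z) / 2.
Definition d_zbar (F : C -> C) (z : C) : C := (partial_x F z + Ci * partial_y F z) / 2.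

Definition laplacian (F : C -> C) (z : C) : C := 4 * d_z (d_zbar F) z.

Definition polyharmonic (p : nat) (F : C -> C) : Prop :=
  C_n (2 * p) F /\
  forall z, unit_disc z -> Nat.iter p laplacian F z = 0.

(* f is the sum of a power series sum_j c_j (v z)^j on the disc, where the
   "variable" v is either z |-> z or complex conjugation. *)
Definition has_expansion (v : C -> C) (f : C -> C) (c : nat -> C) : Prop :=
  forall z, unit_disc z ->
    is_pseries (K := C_AbsRing) (V := C_NormedModule) c (v z) (f z).

(* F is in H_p with analytic parts h_k, g_k (1 <= k <= p) and coefficients
   a_{k,j}, b_{k,j}; vanishing at j = 0 makes the series start at j = 1. *)
Definition in_H (p : nat) (a b : nat -> nat -> C) (h g : nat -> C -> C)
    (F : C -> C) : Prop :=
  polyharmonic p F /\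
  (forall k, (1 <= k <= p)%nat ->
     a k O = 0 /\ b k O = 0 /\
     has_expansion (fun z => z) (h k) (a k) /\
     has_expansion (fun z => z) (g k) (b k)) /\
  (forall z, unit_disc z ->
     F z = sum_n_m (fun k => RtoC (Cmod z ^ (2 * (k - 1)))
                             * (h k z + Cconj (g k z))) 1 p) /\
  a 1%nat 1%nat = 1 /\
  (Cmod (b 1%nat 1%nat) < 1)%R.

Definition in_H0 (p : nat) (a b : nat -> nat -> C) (h g : nat -> C -> C)
    (F : C -> C) : Prop :=
  in_H p a b h g F /\
  b 1%nat 1%nat = 0 /\
  (forall k, (2 <= k <= p)%nat -> a k 1%nat = 0 /\ b k 1%nat = 0).

Definition starlike (p : nat) (alpha : R) (F : C -> C) : Prop :=
  univalent F /\ polyharmonic p F /\ F 0 = 0 /\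
  forall z, unit_disc z -> z <> 0 ->
    (alpha < Re ((z * d_z F z - Cconj z * d_zbar F z) / F z))%R.

(* The coefficients of f as a series in v z; arbitrary if there is none. *)
Definition coef (v : C -> C) (f : C -> C) : nat -> C :=
  epsilon (inhabits (fun _ => RtoC 0)) (has_expansion v f).

Definition hadamard (v : C -> C) (f g : C -> C) (z : C) : C :=
  iota (T := C_CompleteNormedModule)
    (is_pseries (K := C_AbsRing) (V := C_NormedModule)
       (fun j => coef v f j * coef v g j) (v z)).

(* Convolution of series in z, and of series in the conjugate of z. *)
Definition conv (f g : C -> C) : C -> C := hadamard (fun z => z) f g.
Definition conv_bar (f g : C -> C) : C -> C := hadamard Cconj f g.

(* Main.v *)
(* Write L = z F_z - zbar F_zbar.  Applied to a coefficient series, the two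
   convolution kernels multiply the j-th coefficient by an affine function of
   j, so with D = 2 - alpha - alpha xi the displayed sum is
   ((1 + xi) L - (alpha xi + alpha + xi - 1) F) / D.  As xi runs over the unit
   circle, (xi - 1) / (xi + 1) runs over the imaginary axis and infinity, and
   F <> 0 off the origin by univalence; hence the sum never vanishes iff
   Re (L / F) never takes the value alpha.  Since L / F tends to 1 > alpha at
   the origin, the intermediate value theorem on rays shows that this is
   equivalent to Re (L / F) > alpha. *)
Require Import Defs.
From Stdlib Require Import Reals Lra Lia Psatz ClassicalEpsilon Ranalysis5.
From Coquelicot Require Import Coquelicot.
Open Scope C_scope.

(** * Complex power series *)

(** The convolutions are defined through choice: [coef] selects some coefficient sequence and
    [hadamard] selects a sum by [iota]. Neither can be computed until coefficients and sums are
    known to be unique, for series in z and in its conjugate alike; on the real axis the two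
    variables coincide, which settles both cases at once. The factors |z|^(2(k-1)) are constant on
    circles about the origin, so L acts only on the analytic parts: it replaces h_k by z h_k' and
    g_k by -z g_k'. Hence L is a sum of the same shape as F, and the estimates for F apply to it as
    well. Near the origin F and L are both w + O(|w|^2), because the normalisation of H_p^0 leaves w
    as the only linear term. The intermediate value argument is run on |F|^2 (Re (L / F) - alpha), a
    polynomial in the real components of F and L that involves no quotient. *)

Lemma pow_n_Cpow (z : C) (n : nat) : pow_n (K := C_Ring) z n = z ^ n.
Proof. induction n as [|n IH]; [reflexivity|]. simpl. now rewrite IH. Qed.

Local Notation is_Cseries := (is_series (K := C_AbsRing) (V := C_NormedModule)).

Lemma is_Cseries_ext (u v : nat -> C) (l : C) :
  (forall n, u n = v n) -> is_Cseries u l -> is_Cseries v l.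
Proof. apply (is_series_ext (K := C_AbsRing) (V := C_NormedModule)). Qed.

Lemma is_Cseries_scal (k : C) (u : nat -> C) (l : C) :
  is_Cseries u l -> is_Cseries (fun n => k * u n) (k * l).
Proof. apply (is_series_scal (K := C_AbsRing) (V := C_NormedModule)). Qed.

Lemma is_Cseries_plus (u v : nat -> C) (l m : C) :
  is_Cseries u l -> is_Cseries v m -> is_Cseries (fun n => u n + v n) (l + m).
Proof. apply (is_series_plus (K := C_AbsRing) (V := C_NormedModule)). Qed.

Lemma is_Cseries_decr_1 (u : nat -> C) (l : C) :
  is_Cseries (fun n => u (S n)) (l - u O) -> is_Cseries u l.
Proof. apply (is_series_decr_1 (K := C_AbsRing) (V := C_NormedModule)). Qed.

Lemma is_pseries_C (c : nat -> C) (z l : C) :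
  is_pseries (K := C_AbsRing) (V := C_NormedModule) c z l <->
  is_Cseries (fun n => c n * z ^ n) l.
Proof.
  split; apply is_series_ext; intros n;
    rewrite <- (pow_n_Cpow z n); apply Cmult_comm.
Qed.

Lemma is_Cseries_unique (u : nat -> C) (l m : C) :
  is_Cseries u l ->
  is_Cseries u m -> l = m.
Proof.
  intros H1 H2. exact (filterlim_locally_unique (V := C_NormedModule) _ l m H1 H2).
Qed.

Lemma is_lim_seq_Cmod_sum_n (u : nat -> C) (l : C) :
  is_Cseries u l ->
  is_lim_seq (fun n => Cmod (sum_n (G := C_AbelianMonoid) u n)) (Cmod l).
Proof.
  intros H.
  exact (filterlim_comp _ _ _ _ _ _ _ _ H (filterlim_norm (V := C_NormedModule) l)).
Qed.

Lemma is_Cseries_bounded (u : nat -> C) (l : C) :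
  is_Cseries u l ->
  exists M, forall n, (Cmod (u n) <= M)%R.
Proof.
  intros H. apply is_lim_seq_Cmod_sum_n in H. apply is_lim_seq_Reals in H.
  destruct (maj_by_pos _ (exist _ _ H)) as [M [HM0 HM]].
  exists (M + M)%R. intros [|n].
  - specialize (HM 0%nat). rewrite sum_O in HM.
    rewrite Rabs_pos_eq in HM by apply Cmod_ge_0. lra.
  - replace (u (S n)) with (sum_n (G := C_AbelianMonoid) u (S n)
                            + - sum_n (G := C_AbelianMonoid) u n).
    + eapply Rle_trans; [apply Cmod_triangle|]. rewrite Cmod_opp.
      apply Rplus_le_compat;
        (eapply Rle_trans; [apply Rle_abs|]); apply (HM _).
    + rewrite sum_Sn. change plus with Cplus. ring.
Qed.

Lemma is_Cseries_le (u : nat -> C) (b : nat -> R) (l : C) (B : R) :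
  is_Cseries u l ->
  (forall n, (Cmod (u n) <= b n)%R) -> is_series b B -> (Cmod l <= B)%R.
Proof.
  intros Hu Hb HB. apply is_lim_seq_Cmod_sum_n in Hu.
  refine (is_lim_seq_le _ (sum_n b) (Cmod l) B _ Hu HB).
  intros n. eapply Rle_trans; [apply (norm_sum_n_m (V := C_NormedModule) u 0 n)|].
  apply sum_n_m_le. exact Hb.
Qed.

Lemma is_series_Re (u : nat -> C) (l : C) :
  is_Cseries u l ->
  is_series (fun n => Re (u n)) (Re l).
Proof.
  intros H.
  apply (filterlim_ext (fun n => Re (sum_n (G := C_AbelianMonoid) u n))).
  - induction x as [|n IH]; [now rewrite !sum_O|]. rewrite !sum_Sn, <- IH. reflexivity.
  - refine (filterlim_comp _ _ _ _ Re _ (locally l) _ H _).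
    destruct l as [x y]. exact (continuous_fst (U := R_UniformSpace) (V := R_UniformSpace) x y).
Qed.

Definition abs_conv (c : nat -> C) : Prop :=
  forall r, (0 <= r < 1)%R -> ex_series (fun n => Cmod (c n) * r ^ n)%R.

Lemma ex_series_R_le (u v : nat -> R) :
  (forall n, (0 <= u n <= v n)%R) -> ex_series v -> ex_series u.
Proof.
  intros H. apply (ex_series_le (V := R_CompleteNormedModule)).
  intros n. destruct (H n). change (Rabs (u n) <= v n)%R. now rewrite Rabs_pos_eq.
Qed.

(** Convergence at one real point [s] between [r] and 1 bounds the terms [c n * s ^ n], and the
    ratio [r / s] then gives a geometric majorant. *)
Lemma has_expansion_abs_conv (v f : C -> C) (c : nat -> C) :
  (forall x : R, v x = x) -> has_expansion v f c -> abs_conv c.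
Proof.
  intros Hv H r [Hr0 Hr1].
  set (s := ((1 + r) / 2)%R).
  assert (Hs : (0 < s < 1 /\ r < s)%R) by (unfold s; lra).
  assert (Hd : unit_disc (RtoC s)).
  { unfold unit_disc. rewrite Cmod_R, Rabs_pos_eq; lra. }
  specialize (H _ Hd). rewrite Hv in H. apply is_pseries_C in H.
  destruct (is_Cseries_bounded _ _ H) as [M HM].
  apply (ex_series_R_le _ (fun n => M * (r / s) ^ n)%R).
  - intros n. split; [apply Rmult_le_pos; [apply Cmod_ge_0|now apply pow_le]|].
    specialize (HM n). rewrite Cmod_mult, Cmod_pow, Cmod_R, Rabs_pos_eq in HM by lra.
    replace r with (s * (r / s))%R at 1 by (field; lra).
    rewrite Rpow_mult_distr, <- Rmult_assoc. apply Rmult_le_compat_r; [|exact HM].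
    apply pow_le, Rdiv_le_0_compat; lra.
  - apply (ex_series_scal (V := R_NormedModule) M). exists (/ (1 - r / s))%R. apply is_series_geom.
    rewrite Rabs_pos_eq by (apply Rdiv_le_0_compat; lra).
    apply Rlt_div_l; lra.
Qed.

Lemma abs_conv_is_pseries (c : nat -> C) (z : C) :
  abs_conv c -> unit_disc z ->
  exists l : C, is_Cseries (fun n => c n * z ^ n) l.
Proof.
  intros H Hz.
  apply (ex_series_le (K := C_AbsRing) (V := C_CompleteNormedModule) _
           (fun n => Cmod (c n) * Cmod z ^ n)%R).
  - intros n. change (Cmod (c n * z ^ n) <= Cmod (c n) * Cmod z ^ n)%R.
    rewrite Cmod_mult, Cmod_pow. apply Rle_refl.
  - apply H. split; [apply Cmod_ge_0|exact Hz].
Qed.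

(* A factor [n] in the coefficients costs an arbitrarily small increase of the
   radius. *)
Lemma INR_mult_pow_le (r d : R) (n : nat) :
  (0 <= r <= 1)%R -> (0 <= d)%R -> (INR n * d * r ^ n <= (r + d) ^ n)%R.
Proof.
  intros Hr Hd. induction n as [|n IH]; [simpl; lra|].
  assert (r ^ S n <= r ^ n)%R.
  { simpl. assert (0 <= r ^ n)%R by (apply pow_le; lra). nra. }
  assert (r ^ n <= (r + d) ^ n)%R by (apply pow_incr; lra).
  rewrite S_INR. simpl pow in *.
  assert (r * (INR n * d * r ^ n) <= r * (r + d) ^ n)%R by (apply Rmult_le_compat_l; lra).
  assert (d * (r * r ^ n) <= d * (r + d) ^ n)%R by (apply Rmult_le_compat_l; lra).
  lra.
Qed.

Lemma abs_conv_INR_mult (c : nat -> C) :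
  abs_conv c -> abs_conv (fun n => INR n * c n).
Proof.
  intros H r Hr. set (d := ((1 - r) / 2)%R).
  assert (Hd : (0 < d)%R) by (unfold d; lra).
  apply (ex_series_R_le _ (fun n => / d * (Cmod (c n) * (r + d) ^ n))%R).
  - intros n. rewrite Cmod_mult, Cmod_R, Rabs_pos_eq by apply pos_INR.
    pose proof (pos_INR n). pose proof (Cmod_ge_0 (c n)).
    assert (0 <= r ^ n)%R by (apply pow_le; lra).
    split; [apply Rmult_le_pos; [now apply Rmult_le_pos|assumption]|].
    replace (INR n * Cmod (c n) * r ^ n)%R
      with (/ d * (Cmod (c n) * (INR n * d * r ^ n)))%R by (field; lra).
    apply Rmult_le_compat_l; [left; now apply Rinv_0_lt_compat|].
    apply Rmult_le_compat_l; [assumption|]. apply INR_mult_pow_le; lra.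
  - apply (ex_series_scal (V := R_NormedModule)). apply H. unfold d; lra.
Qed.

(** * Termwise complex differentiation *)

(** The mean value bound n r^(n-1) |w - z|, multiplied through by [r] so that no exponent n - 1
    appears. *)
Lemma Cpow_minus_bound (z w : C) (r : R) (n : nat) :
  (Cmod z <= r)%R -> (Cmod w <= r)%R ->
  (r * Cmod (w ^ n - z ^ n) <= INR n * r ^ n * Cmod (w - z))%R.
Proof.
  intros Hz Hw. pose proof (Cmod_ge_0 z) as H0.
  induction n as [|n IH].
  - replace (w ^ 0 - z ^ 0) with (RtoC 0) by (simpl; ring). rewrite Cmod_0. simpl; lra.
  - replace (w ^ S n - z ^ S n) with (z * (w ^ n - z ^ n) + (w - z) * w ^ n)
      by (simpl; ring).
    assert (Hp : (Cmod w ^ n <= r ^ n)%R).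
    { apply pow_incr. split; [apply Cmod_ge_0|exact Hw]. }
    pose proof (Cmod_triangle (z * (w ^ n - z ^ n)) ((w - z) * w ^ n)) as Ht.
    rewrite !Cmod_mult, Cmod_pow in Ht.
    pose proof (Cmod_ge_0 (w - z)). pose proof (Cmod_ge_0 (w ^ n - z ^ n)).
    assert (Cmod z * Cmod (w ^ n - z ^ n) <= r * Cmod (w ^ n - z ^ n))%R
      by (apply Rmult_le_compat_r; assumption).
    assert (Cmod (w - z) * Cmod w ^ n <= Cmod (w - z) * r ^ n)%R
      by (apply Rmult_le_compat_l; assumption).
    rewrite S_INR. simpl pow.
    apply Rle_trans with (r * (INR n * r ^ n * Cmod (w - z) + Cmod (w - z) * r ^ n))%R.
    + apply Rmult_le_compat_l; lra.
    + right; ring.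
Qed.

(** The remainders satisfy E_(n+1) = z E_n + (w - z)(w^n - z^n), so the constants grow from n^2 to
    at most n^2 + n, which is below (n+1)^2. The factor [r * r] again avoids lowered exponents. *)
Lemma Cpow_taylor_bound (z w : C) (r : R) (n : nat) :
  (Cmod z <= r)%R -> (Cmod w <= r)%R ->
  (r * r * Cmod (w ^ n - z ^ n - INR n * z ^ pred n * (w - z))
   <= INR n * INR n * r ^ n * (Cmod (w - z) * Cmod (w - z)))%R.
Proof.
  intros Hz Hw. pose proof (Cmod_ge_0 z) as H0.
  induction n as [|n IH].
  - simpl. replace (1 - 1 - 0 * 1 * (w - z)) with (RtoC 0) by ring. rewrite Cmod_0. lra.
  - set (E := w ^ n - z ^ n - INR n * z ^ pred n * (w - z)) in *.
    replace (w ^ S n - z ^ S n - INR (S n) * z ^ pred (S n) * (w - z))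
      with (z * E + (w - z) * (w ^ n - z ^ n)).
    2: { unfold E. rewrite S_INR, RtoC_plus. destruct n; simpl; ring. }
    pose proof (Cmod_triangle (z * E) ((w - z) * (w ^ n - z ^ n))) as Ht.
    rewrite !Cmod_mult in Ht.
    pose proof (Cpow_minus_bound z w r n Hz Hw) as Hd.
    pose proof (Cmod_ge_0 E). pose proof (Cmod_ge_0 (w - z)) as Hwz.
    assert (Hr : (0 <= r)%R) by lra.
    assert (Hrn : (0 <= r ^ n)%R) by now apply pow_le.
    pose proof (pos_INR n) as Hn.
    set (D := Cmod (w - z)) in *. set (P := Cmod (w ^ n - z ^ n)) in *.
    assert (r * r * (Cmod z * Cmod E) <= r * (INR n * INR n * r ^ n * (D * D)))%R.
    { apply Rle_trans with (r * r * (r * Cmod E))%R.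
      - apply Rmult_le_compat_l; [nra|]. apply Rmult_le_compat_r; assumption.
      - replace (r * r * (r * Cmod E))%R with (r * (r * r * Cmod E))%R by ring.
        apply Rmult_le_compat_l; assumption. }
    assert (r * r * (D * P) <= r * D * (INR n * r ^ n * D))%R.
    { replace (r * r * (D * P))%R with (r * D * (r * P))%R by ring.
      apply Rmult_le_compat_l; [now apply Rmult_le_pos|assumption]. }
    assert (r * r * Cmod (z * E + (w - z) * (w ^ n - z ^ n))
            <= r * r * (Cmod z * Cmod E + D * P))%R
      by (apply Rmult_le_compat_l; [nra|assumption]).
    rewrite S_INR. simpl pow.
    assert (0 <= r * r ^ n * (D * D))%R
      by (apply Rmult_le_pos; apply Rmult_le_pos; assumption).
    nra.
Qed.

(** A quadratic remainder in place of a limit: power series supply it directly, and it restricts to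
    horizontal and vertical lines without any further limit argument. *)
Definition has_cderiv (f : C -> C) (z l : C) : Prop :=
  exists M d, (0 < d)%R /\ forall w, (Cmod (w - z) < d)%R ->
    (Cmod (f w - f z - l * (w - z)) <= M * (Cmod (w - z) * Cmod (w - z)))%R.

(** The derivative [l] is the termwise sum of n c_n z^(n-1). It is tied to [W] by [z * l = W z]
    because only z f' enters the angular derivative, and the coefficients of z f' carry no index
    shift. *)
Lemma has_expansion_cderiv (f W : C -> C) (c : nat -> C) (z : C) :
  has_expansion (fun z => z) f c ->
  has_expansion (fun z => z) W (fun n => INR n * c n) ->
  unit_disc z -> exists l, z * l = W z /\ has_cderiv f z l.
Proof.
  intros Hf HW Hz.
  assert (Hc : abs_conv c) by now apply (has_expansion_abs_conv (fun z => z) f).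
  pose proof (abs_conv_INR_mult _ Hc) as Hc1.
  pose proof (abs_conv_INR_mult _ Hc1) as Hc2.
  pose proof (Cmod_ge_0 z) as Hz0. unfold unit_disc in Hz.
  set (r := ((1 + Cmod z) / 2)%R).
  assert (Hr : (0 < r < 1 /\ Cmod z < r)%R) by (unfold r; lra).
  destruct (ex_series_le (K := C_AbsRing) (V := C_CompleteNormedModule)
           (fun n => c n * (INR n * z ^ pred n))
           (fun n => / r * (Cmod (INR n * c n) * r ^ n))%R) as [l Hl].
  { intros n.
    change (Cmod (c n * (INR n * z ^ pred n)) <= / r * (Cmod (INR n * c n) * r ^ n))%R.
    rewrite !Cmod_mult, Cmod_pow, Cmod_R.
    rewrite Rabs_pos_eq by apply pos_INR.
    destruct n as [|n]; [simpl; lra|]. simpl pred.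
    replace (/ r * (INR (S n) * Cmod (c (S n)) * r ^ S n))%R
      with (Cmod (c (S n)) * (INR (S n) * r ^ n))%R by (simpl; field; lra).
    apply Rmult_le_compat_l; [apply Cmod_ge_0|].
    apply Rmult_le_compat_l; [apply pos_INR|]. apply pow_incr; lra. }
  { apply (ex_series_scal (V := R_NormedModule)). apply Hc1. lra. }
  exists l. split.
  - apply (is_Cseries_unique (fun n => INR n * c n * z ^ n)).
    + apply (is_Cseries_ext
               (fun n => z * (c n * (INR n * z ^ pred n)))).
      * intros [|n]; simpl; ring.
      * exact (is_Cseries_scal z _ l Hl).
    + apply is_pseries_C. now apply HW.
  (* [B] is the sum of n^2 |c_n| r^n, the majorant supplied by the Taylor bound. The distance
     [r - Cmod z] keeps [w] in the disc of radius [r]. *)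
  - destruct (Hc2 r) as [B HB]; [lra|].
    exists (/ (r * r) * B)%R, (r - Cmod z)%R. split; [lra|]. intros w Hw.
    assert (Hwr : (Cmod w <= r)%R).
    { replace w with (z + (w - z)) by ring.
      eapply Rle_trans; [apply Cmod_triangle|]. lra. }
    assert (Hwd : unit_disc w) by (unfold unit_disc; lra).
    specialize (Hf _ Hwd) as Hfw. specialize (Hf _ Hz) as Hfz.
    apply is_pseries_C in Hfw. apply is_pseries_C in Hfz.
    pose proof (is_series_minus _ _ _ _
        (is_series_minus _ _ _ _ Hfw Hfz)
        (is_Cseries_scal (w - z) _ l Hl)) as HS.
    replace (f w - f z - l * (w - z))
      with (plus (plus (f w) (opp (f z))) (opp (scal (w - z) l)) : C).
    2: { change (f w + - f z + - ((w - z) * l) = f w - f z - l * (w - z)). ring. }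
    eapply Rle_trans; [refine (is_Cseries_le _
      (fun n => / (r * r) * (Cmod (w - z) * Cmod (w - z))
                * (Cmod (INR n * (INR n * c n)) * r ^ n))%R _
      (/ (r * r) * (Cmod (w - z) * Cmod (w - z)) * B)%R HS _ _)|].
    + intros n.
      change (Cmod (c n * w ^ n + - (c n * z ^ n)
                    + - ((w - z) * (c n * (INR n * z ^ pred n))))
       <= / (r * r) * (Cmod (w - z) * Cmod (w - z))
                * (Cmod (INR n * (INR n * c n)) * r ^ n))%R.
      replace (c n * w ^ n + - (c n * z ^ n) + - ((w - z) * (c n * (INR n * z ^ pred n))))
        with (c n * (w ^ n - z ^ n - INR n * z ^ pred n * (w - z))) by ring.
      rewrite !Cmod_mult, Cmod_R, Rabs_pos_eq by apply pos_INR.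
      pose proof (Cpow_taylor_bound z w r n ltac:(lra) Hwr) as HT.
      set (E := Cmod (w ^ n - z ^ n - INR n * z ^ pred n * (w - z))) in *.
      replace (Cmod (c n) * E)%R
        with (/ (r * r) * (Cmod (c n) * (r * r * E)))%R by (field; lra).
      apply Rle_trans with (/ (r * r) * (Cmod (c n) *
         (INR n * INR n * r ^ n * (Cmod (w - z) * Cmod (w - z)))))%R.
      * apply Rmult_le_compat_l.
        -- left. apply Rinv_0_lt_compat. nra.
        -- apply Rmult_le_compat_l; [apply Cmod_ge_0|exact HT].
      * right. ring.
    + exact (is_series_scal (V := R_NormedModule) _ _ _ HB).
    + right. ring.
Qed.

(** * Hadamard products *)

Lemma has_expansion_scal (v f : C -> C) (c : nat -> C) (k : C) :
  has_expansion v f c -> has_expansion v (fun z => k * f z) (fun n => k * c n).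
Proof.
  intros H z Hz. apply is_pseries_C.
  apply (is_Cseries_ext
           (fun n => k * (c n * v z ^ n))); [intros n; ring|].
  apply (is_Cseries_scal k).
  apply is_pseries_C. now apply H.
Qed.

(* [z f'(z)] for [f] the sum of [c_n z^n] *)
Definition euler (c : nat -> C) (z : C) : C :=
  epsilon (inhabits (RtoC 0)) (is_Cseries (fun n => INR n * c n * z ^ n)).

Lemma has_expansion_euler (f : C -> C) (c : nat -> C) :
  has_expansion (fun z => z) f c ->
  has_expansion (fun z => z) (euler c) (fun n => INR n * c n).
Proof.
  intros H z Hz. apply is_pseries_C. unfold euler. apply epsilon_spec.
  apply abs_conv_is_pseries; [|exact Hz].
  apply abs_conv_INR_mult. now apply (has_expansion_abs_conv (fun z => z) f).
Qed.

Lemma has_expansion_conj (f : C -> C) (c : nat -> C) :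
  has_expansion (fun z => z) f c ->
  has_expansion Cconj (fun z => Cconj (f z)) (fun n => Cconj (c n)).
Proof.
  intros H z Hz. apply is_pseries_C. specialize (H z Hz). apply is_pseries_C in H.
  apply (is_Cseries_ext
           (fun n => Cconj (c n * z ^ n))).
  { intros n. now rewrite Cmult_conj, Cpow_conj. }
  apply (filterlim_ext
    (fun n => Cconj (sum_n (G := C_AbelianMonoid) (fun k => c k * z ^ k) n))).
  { induction x as [|n IH]; [now rewrite !sum_O|].
    rewrite !sum_Sn, <- IH. apply Cplus_conj. }
  refine (filterlim_comp _ _ _ _ Cconj _ (locally (f z)) _ H _).
  apply (filterlim_locally (U := C_UniformSpace)). intros eps.
  exists eps. intros [x y] [Hx Hy]. split; [exact Hx|].
  change (Rabs (- y - - Im (f z)) < eps)%R.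
  change (Rabs (y - Im (f z)) < eps)%R in Hy.
  replace (- y - - Im (f z))%R with (- (y - Im (f z)))%R by ring.
  now rewrite Rabs_Ropp.
Qed.

Lemma Re_mult_R (a : C) (x : R) : Re (a * x) = (Re a * x)%R.
Proof. unfold Re, Cmult, RtoC; simpl. ring. Qed.

(** At real points [v] is the identity, so taking real parts leaves a real power series for
    [Re (f x)], whose coefficients are determined by its values near 0. *)
Lemma has_expansion_Re_unique (v f : C -> C) (c d : nat -> C) :
  (forall x : R, v x = x) -> has_expansion v f c -> has_expansion v f d ->
  forall n, Re (c n) = Re (d n).
Proof.
  intros Hv.
  assert (Hreal : forall c, has_expansion v f c -> forall x : R, (Rabs x < 1)%R ->
    is_pseries (K := R_AbsRing) (V := R_NormedModule) (fun n => Re (c n)) x (Re (f x))).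
  { intros c' H x Hx. apply is_pseries_R.
    assert (Hd : unit_disc x) by (unfold unit_disc; now rewrite Cmod_R).
    specialize (H _ Hd). rewrite Hv in H. apply is_pseries_C, is_series_Re in H.
    revert H. apply is_series_ext. intros n. now rewrite <- RtoC_pow, Re_mult_R. }
  assert (Hrad : forall c, has_expansion v f c ->
    (* With radius at most 0, the point 1/2 would lie outside the disc of convergence, where the
       terms cannot tend to 0; but the series converges there. *)
    Rbar_lt 0 (CV_radius (fun n => Re (c n)))).
  { intros c' H. apply Rbar_not_le_lt. intros Hle.
    apply (CV_disk_outside (fun n => Re (c' n)) (/ 2)).
    - eapply Rbar_le_lt_trans; [exact Hle|]. simpl. rewrite Rabs_pos_eq; lra.
    - apply ex_series_lim_0. exists (Re (f (/ 2)%R)). apply is_pseries_R.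
      apply (Hreal c' H). rewrite Rabs_pos_eq; lra. }
  intros Hc Hd n.
  apply (PSeries_ext_recip (fun n => Re (c n)) (fun n => Re (d n)));
    [now apply Hrad|now apply Hrad|].
  exists (mkposreal 1 Rlt_0_1). intros x Hx.
  change (Rabs (x - 0) < 1)%R in Hx. rewrite Rminus_0_r in Hx.
  now rewrite (is_pseries_unique _ _ _ (Hreal c Hc x Hx)),
              (is_pseries_unique _ _ _ (Hreal d Hd x Hx)).
Qed.

(** The imaginary parts follow from the statement on real parts, applied to [Ci * f]. *)
Lemma has_expansion_unique (v f : C -> C) (c d : nat -> C) :
  (forall x : R, v x = x) -> has_expansion v f c -> has_expansion v f d ->
  forall n, c n = d n.
Proof.
  intros Hv Hc Hd n.
  pose proof (has_expansion_Re_unique v f c d Hv Hc Hd n) as HR.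
  pose proof (has_expansion_Re_unique v _ _ _ Hv (has_expansion_scal v f c Ci Hc)
                (has_expansion_scal v f d Ci Hd) n) as HI.
  unfold Re, Ci, Cmult in HR, HI; simpl in HI.
  apply injective_projections; lra.
Qed.

(** The kernels have no constant term, so the affine formula must be overridden by 0 at index 0. *)
Definition kernel_coef (A B : C) (n : nat) : C :=
  match n with O => 0 | S _ => A * INR n + B end.

Lemma one_minus_neq_0 (w : C) : unit_disc w -> 1 - w <> 0.
Proof.
  intros Hw E. replace w with (1 - (1 - w)) in Hw by ring. rewrite E in Hw.
  replace (1 - 0) with (RtoC 1) in Hw by ring. unfold unit_disc in Hw.
  rewrite Cmod_1 in Hw. lra.
Qed.

(** The function is A w/(1-w)^2 + B w/(1-w) with w = [v z]. The sums [G] of w^n and [S] of n w^n are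
    found from their shift equations, which can be solved because 1 - w is nonzero. *)
Lemma kernel_expansion (v : C -> C) (A B : C) :
  (forall z, Cmod (v z) = Cmod z) ->
  has_expansion v (fun z => ((A + B) * v z - B * v z ^ 2) / (1 - v z) ^ 2)
    (kernel_coef A B).
Proof.
  intros Hv z Hz. apply is_pseries_C. set (w := v z).
  assert (Hw : unit_disc w) by (unfold unit_disc, w; now rewrite Hv).
  pose proof (one_minus_neq_0 w Hw) as Hw1.
  assert (H1 : abs_conv (fun _ => RtoC 1)).
  { intros r Hr. apply (ex_series_R_le _ (fun n => r ^ n)%R).
    - intros n. rewrite Cmod_1, Rmult_1_l. split; [apply pow_le; lra|lra].
    - exists (/ (1 - r))%R. apply is_series_geom. rewrite Rabs_pos_eq; lra. }
  destruct (abs_conv_is_pseries _ w H1 Hw) as [G HG].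
  destruct (abs_conv_is_pseries _ w (abs_conv_INR_mult _ H1) Hw) as [S HS].
  assert (EG : G = 1 + w * G).
  { apply (is_Cseries_unique _ _ _ HG).
    apply is_Cseries_decr_1.
    replace (1 + w * G - 1 * w ^ 0) with (w * G) by (simpl; ring).
    apply (is_Cseries_ext
             (fun n => w * (1 * w ^ n))); [intros n; simpl; ring|].
    now apply is_Cseries_scal. }
  assert (ES : S = w * (S + G)).
  { apply (is_Cseries_unique _ _ _ HS).
    apply is_Cseries_decr_1.
    replace (w * (S + G) - INR 0 * 1 * w ^ 0) with (w * (S + G)) by (simpl; ring).
    apply (is_Cseries_ext
             (fun n => w * (INR n * 1 * w ^ n + 1 * w ^ n))).
    { intros n. rewrite S_INR, RtoC_plus. simpl; ring. }
    now apply is_Cseries_scal, is_Cseries_plus. }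
  replace (((A + B) * w - B * w ^ 2) / (1 - w) ^ 2) with (A * S + B * (G - 1)).
  - apply (is_Cseries_ext (fun n => A * (INR n * 1 * w ^ n)
             + B * match n with O => 0 | S _ => 1 * w ^ n end)).
    { intros [|n]; unfold kernel_coef; [simpl|]; ring. }
    apply is_Cseries_plus; apply is_Cseries_scal; [exact HS|].
    apply is_Cseries_decr_1.
    replace (G - 1 - 0) with (w * G) by (rewrite EG at 2; ring).
    apply (is_Cseries_ext (fun n => w * (1 * w ^ n))); [intros n; simpl; ring|].
    now apply is_Cseries_scal.
  - assert (EG' : G = / (1 - w)).
    { replace G with (G * (1 - w) / (1 - w)) by (field; assumption).
      replace (G * (1 - w)) with (G - w * G) by ring. rewrite EG at 1.
      field. assumption. }
    assert (ES' : S = w * G / (1 - w)).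
    { replace S with (S * (1 - w) / (1 - w)) by (field; assumption).
      replace (S * (1 - w)) with (S - w * S) by ring. rewrite ES at 1.
      field. assumption. }
    rewrite ES', EG'. field. assumption.
Qed.

(** Uniqueness of coefficients identifies both chosen sequences, and uniqueness of sums identifies
    the [iota]. Since [c O = 0], the 0 in [kernel_coef] at index 0 agrees with the affine multiplier
    there. *)
Lemma hadamard_kernel (v f W K : C -> C) (c : nat -> C) (A B z : C) :
  (forall x : R, v x = x) -> (forall z, Cmod (v z) = Cmod z) ->
  c O = 0 -> has_expansion v f c -> has_expansion v W (fun n => INR n * c n) ->
  (forall z, K z = ((A + B) * v z - B * v z ^ 2) / (1 - v z) ^ 2) ->
  unit_disc z -> hadamard v f K z = A * W z + B * f z.
Proof.
  intros Hv Hm Hc0 Hf HW HK Hz.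
  assert (HK' : has_expansion v K (kernel_coef A B)).
  { intros w Hw. rewrite HK. now apply kernel_expansion. }
  assert (Hcoef : forall g d, has_expansion v g d -> forall n, coef v g n = d n).
  { intros g d Hg. apply (has_expansion_unique v g); [exact Hv| |exact Hg].
    unfold coef. apply epsilon_spec. now exists d. }
  assert (H : is_pseries (K := C_AbsRing) (V := C_NormedModule)
    (fun j => coef v f j * coef v K j) (v z) (A * W z + B * f z)).
  { apply is_pseries_C.
    apply (is_Cseries_ext (fun n => A * (INR n * c n * v z ^ n) + B * (c n * v z ^ n))).
    { intros n. rewrite (Hcoef _ _ Hf), (Hcoef _ _ HK').
      destruct n; unfold kernel_coef; [rewrite Hc0|]; ring. }
    apply is_Cseries_plus; apply is_Cseries_scal; apply is_pseries_C;
      [now apply HW|now apply Hf]. }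
  unfold hadamard. apply (iota_unique (V := C_CompleteNormedModule)); [|exact H].
  intros y Hy. apply is_pseries_C in Hy. apply is_pseries_C in H.
  exact (is_Cseries_unique _ _ _ Hy H).
Qed.

(** * The angular derivative *)

Lemma quadratic_is_derive (u : R -> R) (x l M d : R) :
  (0 < d)%R ->
  (forall t, Rabs t < d -> Rabs (u (x + t) - u x - l * t) <= M * (t * t))%R ->
  is_derive u x l.
Proof.
  intros Hd H. apply is_derive_Reals. intros eps Heps.
  pose proof (Rabs_pos M) as HM.
  (* The difference quotient is off by at most |M| |t|; adding 1 to |M| keeps the divisor positive
     when [M] is 0. *)
  assert (Hm : (0 < Rmin d (eps / (Rabs M + 1)))%R).
  { apply Rmin_glb_lt; [assumption|]. apply Rdiv_lt_0_compat; lra. }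
  exists (mkposreal _ Hm). intros t Ht0 Ht. simpl in Ht.
  assert (Ht1 : (Rabs t < d)%R) by (eapply Rlt_le_trans; [exact Ht|apply Rmin_l]).
  assert (Ht2 : (Rabs t < eps / (Rabs M + 1))%R)
    by (eapply Rlt_le_trans; [exact Ht|apply Rmin_r]).
  specialize (H t Ht1).
  replace ((u (x + t) - u x) / t - l)%R with ((u (x + t) - u x - l * t) / t)%R
    by (field; assumption).
  assert (Hta : (0 < Rabs t)%R) by now apply Rabs_pos_lt.
  unfold Rdiv. rewrite Rabs_mult, Rabs_inv.
  apply Rlt_div_l; [assumption|]. apply Rle_lt_trans with (1 := H).
  rewrite <- (Rabs_pos_eq (t * t)) by nra. rewrite Rabs_mult.
  apply Rlt_div_r in Ht2; [|lra].
  pose proof (Rle_abs M).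
  apply Rle_lt_trans with (Rabs M * (Rabs t * Rabs t))%R.
  - apply Rmult_le_compat_r; nra.
  - nra.
Qed.

(** A relation rather than values of [Derive], so that existence of the four partial derivatives is
    carried along through sums and products. *)
Definition has_gradient (F : C -> C) (z fx fy : C) : Prop :=
  is_derive (fun t : R => Re (F (t, Im z))) (Re z) (Re fx) /\
  is_derive (fun t : R => Im (F (t, Im z))) (Re z) (Im fx) /\
  is_derive (fun t : R => Re (F (Re z, t))) (Im z) (Re fy) /\
  is_derive (fun t : R => Im (F (Re z, t))) (Im z) (Im fy).

(* [w] is [z F_z - zbar F_zbar], that is [-i] times the derivative of
   [F (r e^(i theta))] in [theta]. *)
Definition has_angular (F : C -> C) (z w : C) : Prop :=
  exists fx fy, has_gradient F z fx fy /\ w = - Ci * (Re z * fy - Im z * fx).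

Lemma has_angular_unique (F : C -> C) (z w : C) :
  has_angular F z w -> z * d_z F z - Cconj z * d_zbar F z = w.
Proof.
  intros (fx & fy & (H1 & H2 & H3 & H4) & ->).
  assert (Ex : partial_x F z = fx).
  { unfold partial_x. rewrite (is_derive_unique _ _ _ H1), (is_derive_unique _ _ _ H2).
    now destruct fx. }
  assert (Ey : partial_y F z = fy).
  { unfold partial_y. rewrite (is_derive_unique _ _ _ H3), (is_derive_unique _ _ _ H4).
    now destruct fy. }
  unfold d_z, d_zbar. rewrite Ex, Ey.
  destruct z as [x y], fx as [a b], fy as [c d].
  apply injective_projections; simpl; field.
Qed.

Lemma Im_le_Cmod (z : C) : (Rabs (Im z) <= Cmod z)%R.
Proof.
  eapply Rle_trans; [|apply Rmax_Cmod]. apply Rmax_r.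
Qed.

(** Horizontal increments are [t] and vertical ones [Ci * t], which gives the Cauchy-Riemann
    relation f_y = i f_x. *)
Lemma has_cderiv_gradient (f : C -> C) (z l : C) :
  has_cderiv f z l -> has_gradient f z l (Ci * l).
Proof.
  intros (M & d & Hd & H). destruct z as [x y].
  assert (Hx : forall t, (Rabs t < d)%R ->
    (Cmod (f ((x + t)%R, y) - f (x, y) - l * RtoC t) <= M * (t * t))%R).
  { intros t Ht. specialize (H ((x + t)%R, y)).
    replace (((x + t)%R, y) - (x, y)) with (RtoC t) in H
      by (apply injective_projections; simpl; ring).
    rewrite Cmod_R in H. specialize (H Ht).
    rewrite <- Rabs_mult, (Rabs_pos_eq (t * t)) in H by nra. exact H. }
  assert (Hy : forall t, (Rabs t < d)%R ->
    (Cmod (f (x, (y + t)%R) - f (x, y) - l * (Ci * RtoC t)) <= M * (t * t))%R).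
  { intros t Ht. specialize (H (x, (y + t)%R)).
    replace ((x, (y + t)%R) - (x, y)) with (Ci * RtoC t) in H
      by (apply injective_projections; simpl; ring).
    rewrite Cmod_mult, Cmod_Ci, Rmult_1_l, Cmod_R in H. specialize (H Ht).
    rewrite <- Rabs_mult, (Rabs_pos_eq (t * t)) in H by nra. exact H. }
  split; [|split; [|split]]; apply (quadratic_is_derive _ _ _ M d Hd); intros t Ht;
    [specialize (Hx t Ht)|specialize (Hx t Ht)|specialize (Hy t Ht)|specialize (Hy t Ht)];
    match goal with
    | H : (Cmod ?E <= _)%R |- (Rabs ?e <= _)%R =>
        first
          [ replace e with (Re E) by (unfold Re, Im; simpl; ring);
            eapply Rle_trans; [apply re_le_Cmod|exact H]
          | replace e with (Im E) by (unfold Re, Im; simpl; ring);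
            eapply Rle_trans; [apply Im_le_Cmod|exact H] ]
    end.
Qed.

Lemma has_cderiv_angular (f : C -> C) (z l : C) :
  has_cderiv f z l -> has_angular f z (z * l).
Proof.
  intros H. exists l, (Ci * l). split; [now apply has_cderiv_gradient|].
  destruct z as [x y], l as [u v]. apply injective_projections; simpl; ring.
Qed.

Lemma has_angular_plus (f g : C -> C) (z v w : C) :
  has_angular f z v -> has_angular g z w ->
  has_angular (fun z => f z + g z) z (v + w).
Proof.
  intros (fx & fy & (H1 & H2 & H3 & H4) & ->) (gx & gy & (I1 & I2 & I3 & I4) & ->).
  exists (fx + gx), (fy + gy). split; [|ring].
  split; [|split; [|split]]; now apply (is_derive_plus (V := R_NormedModule)).
Qed.

(** Conjugation commutes with differentiation in the angle but turns the factor -i into i; this is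
    the source of the minus sign on the co-analytic parts. *)
Lemma has_angular_conj (f : C -> C) (z w : C) :
  has_angular f z w -> has_angular (fun z => Cconj (f z)) z (- Cconj w).
Proof.
  intros (fx & fy & (H1 & H2 & H3 & H4) & ->).
  exists (Cconj fx), (Cconj fy). split.
  - split; [|split; [|split]];
      [exact H1|now apply (is_derive_opp (V := R_NormedModule))
      |exact H3|now apply (is_derive_opp (V := R_NormedModule))].
  - apply injective_projections; simpl; ring.
Qed.

Lemma is_derive_norm2_pow (x y : R) (n : nat) :
  is_derive (fun t : R => (t * t + y * y) ^ n)%R x
    (INR n * (2 * x) * (x * x + y * y) ^ pred n)%R.
Proof.
  apply (is_derive_pow (fun t => t * t + y * y)%R). auto_derive; [trivial|ring].
Qed.

Lemma Cmod_pow_even (x y : R) (n : nat) :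
  (Cmod (x, y) ^ (2 * n) = (x * x + y * y) ^ n)%R.
Proof.
  rewrite pow_mult, Cmod2_alt. f_equal. simpl. ring.
Qed.

(** The radial factor is constant in the angle, so the product rule leaves only the term in which
    [f] is differentiated. *)
Lemma has_angular_radial (f : C -> C) (n : nat) (z w : C) :
  has_angular f z w ->
  has_angular (fun z => RtoC (Cmod z ^ (2 * n)) * f z) z
    (RtoC (Cmod z ^ (2 * n)) * w).
Proof.
  intros (fx & fy & (H1 & H2 & H3 & H4) & ->). destruct z as [x y].
  simpl Re in *. simpl Im in *.
  set (q := (Cmod (x, y) ^ (2 * n))%R).
  set (qx := (INR n * (2 * x) * (x * x + y * y) ^ pred n)%R).
  set (qy := (INR n * (2 * y) * (x * x + y * y) ^ pred n)%R).
  exists (RtoC qx * f (x, y) + RtoC q * fx), (RtoC qy * f (x, y) + RtoC q * fy). split.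
  - assert (Hq : q = ((x * x + y * y) ^ n)%R) by apply Cmod_pow_even.
    pose proof (is_derive_norm2_pow x y n) as Hx. fold qx in Hx.
    assert (Hy : is_derive (fun t : R => (x * x + t * t) ^ n)%R y qy).
    { unfold qy. rewrite (Rplus_comm (x * x)).
      apply (is_derive_ext (fun t => (t * t + x * x) ^ n)%R);
        [intros t; now rewrite Rplus_comm|apply is_derive_norm2_pow]. }
    pose proof (Derive.is_derive_mult _ _ _ _ _ Hx H1) as K1.
    pose proof (Derive.is_derive_mult _ _ _ _ _ Hx H2) as K2.
    pose proof (Derive.is_derive_mult _ _ _ _ _ Hy H3) as K3.
    pose proof (Derive.is_derive_mult _ _ _ _ _ Hy H4) as K4.
    cbv beta in K1, K2, K3, K4. rewrite <- Hq in K1, K2, K3, K4.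
    split; [|split; [|split]];
      [revert K1|revert K2|revert K3|revert K4];
      match goal with
      | |- is_derive _ _ ?a -> is_derive _ _ ?b =>
          replace b with a by (unfold Re, Im; simpl; ring)
      end;
      apply is_derive_ext; intros t; rewrite Cmod_pow_even; unfold Re, Im; simpl; ring.
  (* The angular derivative of the radial factor vanishes. *)
  - assert (Hxy : (x * qy - y * qx = 0)%R) by (unfold qx, qy; ring).
    transitivity (RtoC q * (- Ci * (x * fy - y * fx)) + - Ci * RtoC (x * qy - y * qx)%R * f (x, y)).
    + rewrite Hxy. change (Re (x, y)) with x. change (Im (x, y)) with y. ring.
    + rewrite RtoC_minus, !RtoC_mult. change (Re (x, y)) with x. change (Im (x, y)) with y. ring.
Qed.

Lemma has_angular_zero (z : C) : has_angular (fun _ => 0) z 0.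
Proof.
  exists 0, 0. split; [|ring].
  split; [|split; [|split]]; apply (is_derive_const (V := R_NormedModule)).
Qed.

Lemma has_angular_sum (T : nat -> C -> C) (w : nat -> C) (z : C) (p : nat) :
  (forall k, (1 <= k <= p)%nat -> has_angular (T k) z (w k)) ->
  has_angular (fun z => sum_n_m (fun k => T k z) 1 p) z (sum_n_m w 1 p).
Proof.
  induction p as [|p IH]; intros H.
  - rewrite sum_n_m_zero by lia.
    destruct (has_angular_zero z) as (fx & fy & (H1 & H2 & H3 & H4) & E).
    exists fx, fy. split; [|exact E].
    split; [|split; [|split]];
      [revert H1|revert H2|revert H3|revert H4]; apply is_derive_ext; intros t;
      rewrite sum_n_m_zero by lia; reflexivity.
  - rewrite sum_n_Sm by lia.
    assert (Hs : has_angular (fun z => sum_n_m (fun k => T k z) 1 p + T (S p) z) z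
                   (sum_n_m w 1 p + w (S p))).
    { apply has_angular_plus; [apply IH; intros k Hk|]; apply H; lia. }
    destruct Hs as (fx & fy & (H1 & H2 & H3 & H4) & E).
    exists fx, fy. split; [|exact E].
    split; [|split; [|split]];
      [revert H1|revert H2|revert H3|revert H4]; apply is_derive_ext; intros t;
      rewrite sum_n_Sm by lia; reflexivity.
Qed.

Lemma unit_disc_norm2 (x y : R) : unit_disc (x, y) <-> (x * x + y * y < 1)%R.
Proof.
  unfold unit_disc. pose proof (Cmod2_alt (x, y)) as H. simpl in H.
  pose proof (Cmod_ge_0 (x, y)). split; intros; nra.
Qed.

Lemma locally_norm2_lt (x y : R) :
  (x * x + y * y < 1)%R -> locally x (fun t : R => (t * t + y * y < 1)%R).
Proof.
  intros H.
  apply (open_comp (fun t : R => t * t + y * y)%R (fun s => s < 1)%R).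
  - intros t _. apply (ex_derive_continuous (V := R_NormedModule)
      (fun t : R => t * t + y * y)%R t). auto_derive. trivial.
  - apply open_lt.
  - exact H.
Qed.

(** The partial derivatives are local along each coordinate line, and the disc meets such a line in
    an open set. *)
Lemma has_angular_ext_disc (f g : C -> C) (z w : C) :
  unit_disc z -> (forall z, unit_disc z -> f z = g z) ->
  has_angular f z w -> has_angular g z w.
Proof.
  intros Hz Hfg (fx & fy & (H1 & H2 & H3 & H4) & E). exists fx, fy. split; [|exact E].
  destruct z as [x y]. apply unit_disc_norm2 in Hz. simpl Re in *. simpl Im in *.
  pose proof (locally_norm2_lt x y Hz) as Lx.
  rewrite Rplus_comm in Hz. pose proof (locally_norm2_lt y x Hz) as Ly.
  assert (Ex : locally x (fun t : R => f (t, y) = g (t, y))).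
  { revert Lx. apply filter_imp. intros t Ht. now apply Hfg, unit_disc_norm2. }
  assert (Ey : locally y (fun t : R => f (x, t) = g (x, t))).
  { revert Ly. apply filter_imp. intros t Ht. apply Hfg, unit_disc_norm2. lra. }
  split; [|split; [|split]];
    [revert H1|revert H2|revert H3|revert H4]; apply is_derive_ext_loc;
    simpl Re; simpl Im;
    [revert Ex|revert Ex|revert Ey|revert Ey]; apply filter_imp; now intros t ->.
Qed.

(** * Behaviour at the origin and along rays *)

Lemma has_expansion_tangent (f : C -> C) (c : nat -> C) :
  has_expansion (fun z => z) f c -> c O = 0 ->
  exists M, forall w, (Cmod w <= / 2)%R ->
    (Cmod (f w - c 1%nat * w) <= M * (Cmod w * Cmod w))%R.
Proof.
  intros Hf Hc0.
  assert (Hc : abs_conv c) by now apply (has_expansion_abs_conv (fun z => z) f).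
  destruct (Hc (/ 2)%R) as [B HB]; [lra|].
  (* For |w| at most 1/2 and n at least 2, |w|^n is at most |w|^2 (1/2)^(n-2); the 4 restores the
     exponent n in the sum [B]. *)
  exists (4 * B)%R. intros w Hw.
  assert (Hd : unit_disc w) by (unfold unit_disc; lra).
  specialize (Hf w Hd). apply is_pseries_C in Hf.
  set (u := fun n => match n with O | 1%nat => RtoC 0 | _ => c n * w ^ n end).
  assert (Hu : is_Cseries u (f w - c 1%nat * w)).
  { apply (is_Cseries_ext (fun n => c n * w ^ n
        + - c 1%nat * match n with 1%nat => w | _ => 0 end)).
    { intros [|[|n]]; unfold u; [rewrite Hc0|..]; simpl; ring. }
    replace (f w - c 1%nat * w) with (f w + - c 1%nat * w) by ring.
    apply is_Cseries_plus; [exact Hf|]. apply is_Cseries_scal.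
    apply is_Cseries_decr_1, is_Cseries_decr_1.
    replace (w - 0 - w) with (0 * 0) by ring.
    apply (is_Cseries_ext (fun n => 0 * 0)); [intros n; ring|].
    apply (is_Cseries_ext (fun n => 0 * (c n * w ^ n))); [intros n; ring|].
    replace (0 * 0) with (0 * f w) by ring. now apply is_Cseries_scal. }
  eapply Rle_trans; [refine (is_Cseries_le _
    (fun n => 4 * (Cmod w * Cmod w) * (Cmod (c n) * (/ 2) ^ n))%R _
    (4 * (Cmod w * Cmod w) * B)%R Hu _ _)|right; ring].
  - pose proof (Cmod_ge_0 w) as Hw0.
    intros n.
    assert (0 <= 4 * (Cmod w * Cmod w) * (Cmod (c n) * (/ 2) ^ n))%R.
    { apply Rmult_le_pos; [nra|]. apply Rmult_le_pos; [apply Cmod_ge_0|].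
      apply pow_le; lra. }
    destruct n as [|[|n]]; unfold u; [now rewrite Cmod_0|now rewrite Cmod_0|].
    rewrite Cmod_mult, Cmod_pow.
    replace (4 * (Cmod w * Cmod w) * (Cmod (c (S (S n))) * (/ 2) ^ S (S n)))%R
      with (Cmod (c (S (S n))) * (Cmod w * (Cmod w * (/ 2) ^ n)))%R by (simpl; field).
    apply Rmult_le_compat_l; [apply Cmod_ge_0|].
    simpl. apply Rmult_le_compat_l; [assumption|]. apply Rmult_le_compat_l; [assumption|].
    apply pow_incr. lra.
  - exact (is_series_scal (V := R_NormedModule) _ _ _ HB).
Qed.

Lemma sum_n_m_quadratic (T : nat -> C -> C) (m n : nat) :
  (forall k, (m <= k <= n)%nat -> exists M, forall w, (Cmod w <= / 2)%R ->
     (Cmod (T k w) <= M * (Cmod w * Cmod w))%R) ->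
  exists M, forall w, (Cmod w <= / 2)%R ->
    (Cmod (sum_n_m (fun k => T k w) m n) <= M * (Cmod w * Cmod w))%R.
Proof.
  assert (Hzero : forall n, (n < m)%nat -> exists M, forall w, (Cmod w <= / 2)%R ->
    (Cmod (sum_n_m (fun k => T k w) m n) <= M * (Cmod w * Cmod w))%R).
  { intros n' Hn. exists 0%R. intros w _. rewrite sum_n_m_zero by exact Hn.
    change (Cmod 0 <= 0 * (Cmod w * Cmod w))%R. rewrite Cmod_0. lra. }
  induction n as [|n IH]; intros H.
  - destruct m as [|m]; [|apply Hzero; lia].
    destruct (H O) as [M HM]; [lia|]. exists M. intros w Hw. rewrite sum_n_n. now apply HM.
  - destruct (Nat.le_gt_cases m (S n)) as [Hmn|Hmn]; [|apply Hzero; lia].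
    destruct IH as [M HM]; [intros k Hk; apply H; lia|].
    destruct (H (S n)) as [M' HM']; [lia|].
    exists (M + M')%R. intros w Hw. rewrite sum_n_Sm by exact Hmn.
    change plus with Cplus. eapply Rle_trans; [apply Cmod_triangle|].
    rewrite Rmult_plus_distr_r. apply Rplus_le_compat; [now apply HM|now apply HM'].
Qed.

Definition polyh_sum (p : nat) (h g : nat -> C -> C) (z : C) : C :=
  sum_n_m (fun k => RtoC (Cmod z ^ (2 * (k - 1))) * (h k z + Cconj (g k z))) 1 p.

(** Stated for arbitrary coefficient families because it serves twice: for [F], and for its angular
    derivative with coefficients n a and -n b, which satisfy the same normalisation at index 1. *)
Lemma polyh_sum_tangent (p : nat) (a b : nat -> nat -> C) (h g : nat -> C -> C) :
  (1 <= p)%nat ->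
  (forall k, (1 <= k <= p)%nat -> a k O = 0 /\ b k O = 0 /\
     has_expansion (fun z => z) (h k) (a k) /\ has_expansion (fun z => z) (g k) (b k)) ->
  a 1%nat 1%nat = 1 -> b 1%nat 1%nat = 0 ->
  (forall k, (2 <= k <= p)%nat -> a k 1%nat = 0 /\ b k 1%nat = 0) ->
  exists M, forall w, (Cmod w <= / 2)%R ->
    (Cmod (polyh_sum p h g w - w) <= M * (Cmod w * Cmod w))%R.
Proof.
  intros Hp H Ha1 Hb1 Hk1.
  assert (Hterm : forall k, (1 <= k <= p)%nat -> exists M, forall w, (Cmod w <= / 2)%R ->
    (Cmod (RtoC (Cmod w ^ (2 * (k - 1)))
           * (h k w - a k 1%nat * w + Cconj (g k w - b k 1%nat * w)))
     <= M * (Cmod w * Cmod w))%R).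
  { intros k Hk. destruct (H k Hk) as (Ha0 & Hb0 & Hh & Hg).
    destruct (has_expansion_tangent _ _ Hh Ha0) as [M HM].
    destruct (has_expansion_tangent _ _ Hg Hb0) as [M' HM'].
    exists (M + M')%R. intros w Hw. specialize (HM w Hw). specialize (HM' w Hw).
    pose proof (Cmod_ge_0 w). rewrite Cmod_mult, Cmod_R.
    assert (Hq : (Rabs (Cmod w ^ (2 * (k - 1))) <= 1)%R).
    { rewrite Rabs_pos_eq by now apply pow_le.
      rewrite <- (pow1 (2 * (k - 1))). apply pow_incr. lra. }
    pose proof (Cmod_triangle (h k w - a k 1%nat * w) (Cconj (g k w - b k 1%nat * w))) as Ht.
    rewrite Cmod_conj in Ht.
    pose proof (Cmod_ge_0 (h k w - a k 1%nat * w + Cconj (g k w - b k 1%nat * w))).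
    apply Rle_trans with
      (1 * Cmod (h k w - a k 1%nat * w + Cconj (g k w - b k 1%nat * w)))%R.
    - now apply Rmult_le_compat_r.
    - lra. }
  destruct (Hterm 1%nat) as [M HM]; [lia|].
  destruct (sum_n_m_quadratic (fun k w => RtoC (Cmod w ^ (2 * (k - 1)))
     * (h k w + Cconj (g k w))) 2 p) as [M' HM'].
  { intros k Hk. destruct (Hterm k) as [N HN]; [lia|]. exists N. intros w Hw.
    specialize (HN w Hw). destruct (Hk1 k Hk) as [Ea Eb]. rewrite Ea, Eb in HN.
    replace (h k w - 0 * w) with (h k w) in HN by ring.
    replace (g k w - 0 * w) with (g k w) in HN by ring. exact HN. }
  exists (M + M')%R. intros w Hw. specialize (HM w Hw). specialize (HM' w Hw).
  unfold polyh_sum. rewrite sum_Sn_m by exact Hp. change plus with Cplus.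
  set (s := sum_n_m _ 2 p) in *.
  replace (_ + s - w) with (RtoC (Cmod w ^ (2 * (1 - 1)))
     * (h 1%nat w - a 1%nat 1%nat * w + Cconj (g 1%nat w - b 1%nat 1%nat * w)) + s).
  - eapply Rle_trans; [apply Cmod_triangle|]. lra.
  - rewrite Ha1, Hb1. simpl. replace (g 1%nat w - 0 * w) with (g 1%nat w) by ring. ring.
Qed.

Lemma C_n_S_continuous (n : nat) (F : C -> C) (z : C) :
  C_n (S n) F -> unit_disc z ->
  continuous F z /\ continuous (partial_x F) z /\ continuous (partial_y F) z.
Proof.
  intros (H & _ & Hx & Hy) Hz. split; [now apply H|].
  destruct n; [split; [now apply Hx|now apply Hy]|].
  split; [now apply Hx|now apply Hy].
Qed.

Lemma continuity_pt_ray (G : C -> C) (z : C) (t : R) :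
  continuous G (t * z) ->
  continuity_pt (fun s : R => Re (G (s * z))) t /\
  continuity_pt (fun s : R => Im (G (s * z))) t.
Proof.
  intros HG.
  assert (Hs : continuous (fun s : R => RtoC s * z) t).
  { destruct z as [x y].
    assert (Hlin : forall u : R, continuous (fun s : R => s * u)%R t).
    { intros u. apply (ex_derive_continuous (V := R_NormedModule) (fun s : R => s * u)%R t).
      auto_derive. trivial. }
    apply (continuous_ext (fun s : R => (s * x, s * y)%R : C)).
    { intros s. apply injective_projections; simpl; ring. }
    apply (continuous_comp_2 (fun s : R => s * x)%R (fun s : R => s * y)%R
             (fun a b => (a, b) : C)); [apply Hlin|apply Hlin|].
    apply (continuous_ext (fun q : C => q)); [now intros []|apply continuous_id]. }
  assert (HGs : continuous (fun s : R => G (RtoC s * z)) t)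
    by now apply (continuous_comp (fun s : R => RtoC s * z) G).
  split; apply continuity_pt_filterlim;
    [apply (continuous_comp (fun s : R => G (RtoC s * z)) (fst (A := R) (B := R)))
    |apply (continuous_comp (fun s : R => G (RtoC s * z)) (snd (A := R) (B := R)))];
    try exact HGs; destruct (G (RtoC t * z)); [apply continuous_fst|apply continuous_snd].
Qed.

Definition angular (F : C -> C) (z : C) : C := z * d_z F z - Cconj z * d_zbar F z.

(* [|F|^2 (Re (L / F) - alpha)] without division, where [L = angular F]. *)
Definition excess (alpha : R) (F : C -> C) (z : C) : R :=
  Re ((angular F z - alpha * F z) * Cconj (F z)).

Lemma angular_partials (F : C -> C) (z : C) :
  angular F z = - Ci * (Re z * partial_y F z - Im z * partial_x F z).
Proof.
  unfold angular, d_z, d_zbar.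
  destruct z as [x y], (partial_x F (x, y)), (partial_y F (x, y)).
  apply injective_projections; simpl; field.
Qed.

Lemma excess_ray_continuous (n : nat) (alpha : R) (F : C -> C) (z : C) (t : R) :
  C_n (S n) F -> unit_disc (t * z) ->
  continuity_pt (fun s : R => excess alpha F (s * z)) t.
Proof.
  intros HF Hz. destruct (C_n_S_continuous n F _ HF Hz) as (H0 & Hx & Hy).
  apply continuity_pt_ray in H0, Hx, Hy.
  destruct H0 as [H1 H2], Hx as [H3 H4], Hy as [H5 H6].
  set (f1 := fun s : R => Re (F (s * z))) in *.
  set (f2 := fun s : R => Im (F (s * z))) in *.
  set (f3 := fun s : R => Re (partial_x F (s * z))) in *.
  set (f4 := fun s : R => Im (partial_x F (s * z))) in *.
  set (f5 := fun s : R => Re (partial_y F (s * z))) in *.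
  set (f6 := fun s : R => Im (partial_y F (s * z))) in *.
  (* In real components the excess is a polynomial in [s] and six real functions already known to be
     continuous at [t]. *)
  apply (continuity_pt_ext (fun s =>
     (s * Re z * f6 s - s * Im z * f4 s - alpha * f1 s) * f1 s
     + (s * Im z * f3 s - s * Re z * f5 s - alpha * f2 s) * f2 s)%R).
  { intros s. unfold excess. rewrite angular_partials.
    unfold f1, f2, f3, f4, f5, f6.
    destruct z as [x y], (F (s * (x, y))), (partial_x F (s * (x, y))),
      (partial_y F (s * (x, y))).
    unfold Re, Im; simpl. ring. }
  clearbody f1 f2 f3 f4 f5 f6. reg.
Qed.

(** With F = w + u and L = w + v, where u and v have modulus at most e r, the main term is (1 -
    alpha) r^2 = 7 e r^2. The rest has modulus at most e r^2 + (2 e r)(2 r) = 5 e r^2, which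
    explains the 7. *)
Lemma excess_near_0 (alpha M M' : R) (F : C -> C) (w : C) :
  (0 <= alpha < 1)%R ->
  (Cmod (F w - w) <= M * (Cmod w * Cmod w))%R ->
  (Cmod (angular F w - w) <= M' * (Cmod w * Cmod w))%R ->
  w <> 0 -> ((Rabs M + Rabs M') * Cmod w < (1 - alpha) / 7)%R ->
  (0 < excess alpha F w)%R.
Proof.
  intros Ha HF HL Hw Hs. apply Cmod_gt_0 in Hw.
  set (r := Cmod w) in *. set (e := ((1 - alpha) / 7)%R) in *.
  assert (He : (0 < e <= / 7)%R) by (unfold e; lra).
  set (u := F w - w) in *. set (v := angular F w - w) in *.
  pose proof (Rabs_pos M). pose proof (Rabs_pos M').
  pose proof (Rle_abs M). pose proof (Rle_abs M').
  assert (Hu : (Cmod u <= e * r)%R).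
  { apply Rle_trans with (1 := HF). rewrite <- Rmult_assoc. apply Rmult_le_compat_r; nra. }
  assert (Hv : (Cmod v <= e * r)%R).
  { apply Rle_trans with (1 := HL). rewrite <- Rmult_assoc. apply Rmult_le_compat_r; nra. }
  unfold excess. replace (F w) with (w + u) by (unfold u; ring).
  replace (angular F w) with (w + v) by (unfold v; ring).
  set (rest := (1 - alpha) * w * Cconj u + (v - alpha * u) * Cconj (w + u)).
  replace ((w + v - alpha * (w + u)) * Cconj (w + u))
    with (RtoC ((1 - alpha) * r ^ 2) + rest).
  2: { unfold r, rest. rewrite RtoC_mult, Cmod2_conj, RtoC_minus, !Cplus_conj. ring. }
  assert (Hrest : (Cmod rest <= 5 * e * (r * r))%R).
  { unfold rest. eapply Rle_trans; [apply Cmod_triangle|].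
    rewrite !Cmod_mult, !Cmod_conj.
    assert (K1 : (Cmod (1 - alpha) <= 1)%R).
    { rewrite <- RtoC_minus, Cmod_R, Rabs_pos_eq; lra. }
    assert (K2 : (Cmod (v - alpha * u) <= 2 * e * r)%R).
    { replace (v - alpha * u) with (v + - alpha * u) by ring.
      eapply Rle_trans; [apply Cmod_triangle|].
      rewrite Cmod_mult, Cmod_opp, Cmod_R, Rabs_pos_eq by lra.
      pose proof (Cmod_ge_0 u). nra. }
    assert (K3 : (Cmod (w + u) <= 2 * r)%R).
    { eapply Rle_trans; [apply Cmod_triangle|]. fold r. nra. }
    fold r.
    pose proof (Cmod_ge_0 (1 - alpha)). pose proof (Cmod_ge_0 u).
    pose proof (Cmod_ge_0 (v - alpha * u)). pose proof (Cmod_ge_0 (w + u)).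
    assert (Cmod (1 - alpha) * r * Cmod u <= 1 * r * (e * r))%R.
    { apply Rmult_le_compat; [nra|assumption|nra|assumption]. }
    assert (Cmod (v - alpha * u) * Cmod (w + u) <= 2 * e * r * (2 * r))%R
      by (apply Rmult_le_compat; assumption).
    lra. }
  pose proof (re_le_Cmod rest) as Hre.
  replace (Re (RtoC ((1 - alpha) * r ^ 2) + rest)) with ((1 - alpha) * r ^ 2 + Re rest)%R
    by (unfold Re; simpl; ring).
  assert (E : (1 - alpha = 7 * e)%R) by (unfold e; field). rewrite E.
  pose proof (Rle_abs (- Re rest)) as Hn. rewrite Rabs_Ropp in Hn.
  assert (0 < e * (r * r))%R by (apply Rmult_lt_0_compat; nra).
  simpl pow. nra.
Qed.

Lemma excess_zero_exists (n : nat) (alpha M M' : R) (F : C -> C) (z : C) :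
  (0 <= alpha < 1)%R -> C_n (S n) F ->
  (forall w, (Cmod w <= / 2)%R -> (Cmod (F w - w) <= M * (Cmod w * Cmod w))%R) ->
  (forall w, (Cmod w <= / 2)%R ->
     (Cmod (angular F w - w) <= M' * (Cmod w * Cmod w))%R) ->
  unit_disc z -> z <> 0 -> (excess alpha F z <= 0)%R ->
  exists w, unit_disc w /\ w <> 0 /\ excess alpha F w = 0%R.
Proof.
  intros Ha HC HF HL Hz Hz0 Hneg.
  (* The intermediate value theorem used below needs strict signs at both ends, so a zero at [z]
     itself is split off. *)
  destruct (Req_dec (excess alpha F z) 0) as [E|Hne]; [now exists z|].
  pose proof (proj1 (Cmod_gt_0 z) Hz0) as Hr. unfold unit_disc in Hz.
  pose proof (Rabs_pos M). pose proof (Rabs_pos M').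
  assert (Hd : forall t, (0 < t <= 1)%R -> Cmod (t * z) = (t * Cmod z)%R /\ t * z <> 0).
  { intros t Ht.
    assert (E : Cmod (t * z) = (t * Cmod z)%R)
      by (rewrite Cmod_mult, Cmod_R, Rabs_pos_eq; lra).
    split; [exact E|]. apply Cmod_gt_0. rewrite E. nra. }
  set (K := (Rabs M + Rabs M' + 1)%R).
  (* The first bound puts [t0 * z] in the disc of radius 1/2, where the tangent estimates hold; the
     second gives the smallness required by [excess_near_0]. *)
  set (t0 := Rmin (/ 2) ((1 - alpha) / 7 / K)).
  assert (Hq : (0 < (1 - alpha) / 7 / K)%R)
    by (apply Rdiv_lt_0_compat; unfold K; lra).
  assert (Ht0 : (0 < t0 <= / 2)%R).
  { split; [apply Rmin_glb_lt; lra|apply Rmin_l]. }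
  assert (HtK : (t0 * K <= (1 - alpha) / 7)%R).
  { apply Rle_trans with ((1 - alpha) / 7 / K * K)%R.
    - apply Rmult_le_compat_r; [unfold K; lra|apply Rmin_r].
    - right. field. unfold K; lra. }
  destruct (Hd t0 ltac:(lra)) as [E0 N0].
  assert (Hpos : (0 < excess alpha F (t0 * z))%R).
  { assert (Hh : (Cmod (t0 * z) <= / 2)%R) by (rewrite E0; nra).
    apply (excess_near_0 alpha M M'); [exact Ha|now apply HF|now apply HL|exact N0|].
    rewrite E0.
    assert (0 < t0 * Cmod z < t0)%R by nra.
    unfold K in HtK. nra. }
  destruct (IVT_interv (fun t : R => - excess alpha F (t * z))%R t0 1) as [t [Ht Et]].
  - intros t Ht. apply continuity_pt_opp.
    apply (excess_ray_continuous n); [exact HC|].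
    unfold unit_disc. rewrite (proj1 (Hd t ltac:(lra))). nra.
  - lra.
  - lra.
  - replace (1%R * z) with z by ring. lra.
  - exists (t * z). destruct (Hd t ltac:(lra)) as [E N].
    split; [unfold unit_disc; rewrite E; nra|]. split; [exact N|]. lra.
Qed.

(** * The circle condition *)

Lemma excess_quotient (alpha : R) (F : C -> C) (z : C) :
  F z <> 0 -> excess alpha F z = (Cmod (F z) ^ 2 * (Re (angular F z / F z) - alpha))%R.
Proof.
  intros HF. unfold excess.
  replace ((angular F z - alpha * F z) * Cconj (F z))
    with ((angular F z / F z - alpha) * RtoC (Cmod (F z) ^ 2)%R).
  - rewrite Re_mult_R, Rmult_comm. reflexivity.
  - rewrite Cmod2_conj. field. exact HF.
Qed.

(** For nonzero [f] this is the Cayley transform without division: m / f is purely imaginary exactly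
    when it is equidistant from 1 and -1. *)
Lemma Cmod_plus_eq_minus (m f : C) :
  Cmod (f + m) = Cmod (f - m) <-> Re (m * Cconj f) = 0%R.
Proof.
  assert (E : (Cmod (f + m) ^ 2 - Cmod (f - m) ^ 2 = 4 * Re (m * Cconj f))%R).
  { rewrite !Cmod2_alt. destruct m, f. unfold Re, Im; simpl. ring. }
  pose proof (Cmod_ge_0 (f + m)). pose proof (Cmod_ge_0 (f - m)).
  split; intros Heq; [rewrite Heq in E; lra|].
  rewrite Heq in E. apply Rsqr_inj; [assumption|assumption|]. unfold Rsqr. lra.
Qed.

(** With m = l - alpha f the equation becomes f + m = xi (f - m). In this form there is no division
    by 1 + xi, so xi = -1 is no separate case. *)
Lemma circle_condition_vanish (alpha : R) (xi l f : C) :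
  Cmod xi = 1%R -> (1 + xi) * l = (alpha * xi + alpha + xi - 1) * f ->
  Re ((l - alpha * f) * Cconj f) = 0%R.
Proof.
  intros Hxi H. apply Cmod_plus_eq_minus. set (m := l - alpha * f).
  replace (f + m) with (xi * (f - m)).
  - rewrite Cmod_mult, Hxi. apply Rmult_1_l.
  - replace (f + m) with
      (xi * (f - m) + ((1 + xi) * l - (alpha * xi + alpha + xi - 1) * f))
      by (unfold m; ring).
    rewrite H. ring.
Qed.

(* Cayley transform of the imaginary number [(l - alpha f) / f] *)
Lemma circle_condition_exists (alpha : R) (l f : C) :
  f <> 0 -> Re ((l - alpha * f) * Cconj f) = 0%R ->
  exists xi, Cmod xi = 1%R /\ (1 + xi) * l = (alpha * xi + alpha + xi - 1) * f.
Proof.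
  intros Hf H. apply Cmod_plus_eq_minus in H. set (m := l - alpha * f) in *.
  assert (Hd : f - m <> 0).
  { intros E. rewrite E, Cmod_0 in H. apply Cmod_eq_0 in H. apply Hf.
    replace f with ((f + m + (f - m)) / 2) by field. rewrite E, H. field. }
  exists ((f + m) / (f - m)). split.
  - rewrite Cmod_div by exact Hd. rewrite H. field. apply Cmod_gt_0 in Hd. lra.
  - replace l with (m + alpha * f) by (unfold m; ring). field. exact Hd.
Qed.

(** Otherwise 2 = alpha (1 + xi), whose modulus is at most 2 alpha < 2. *)
Lemma circle_denominator_neq_0 (alpha : R) (xi : C) :
  (0 <= alpha < 1)%R -> Cmod xi = 1%R -> 2 - alpha - alpha * xi <> 0.
Proof.
  intros Ha Hxi E. assert (E' : RtoC 2 = alpha * (1 + xi)).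
  { replace (RtoC 2) with (2 - alpha - alpha * xi + alpha * (1 + xi)) by ring.
    rewrite E. ring. }
  apply (f_equal Cmod) in E'. rewrite Cmod_mult, !Cmod_R, !Rabs_pos_eq in E' by lra.
  pose proof (Cmod_triangle 1 xi) as Ht. rewrite Cmod_1, Hxi in Ht.
  pose proof (Cmod_ge_0 (1 + xi)). nra.
Qed.

(** * The convolution sum in terms of [F] and its angular derivative *)

Lemma angular_polyh_sum (p : nat) (a b : nat -> nat -> C) (h g : nat -> C -> C)
    (F : C -> C) (z : C) :
  (forall k, (1 <= k <= p)%nat ->
     has_expansion (fun z => z) (h k) (a k) /\ has_expansion (fun z => z) (g k) (b k)) ->
  (forall z, unit_disc z -> F z = polyh_sum p h g z) ->
  unit_disc z ->
  angular F z = polyh_sum p (fun k => euler (a k)) (fun k z => RtoC (-1) * euler (b k) z) z.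
Proof.
  intros H HF Hz. apply has_angular_unique.
  apply (has_angular_ext_disc (polyh_sum p h g)); [exact Hz|intros w Hw; now rewrite HF|].
  apply (has_angular_sum (fun k z => RtoC (Cmod z ^ (2 * (k - 1))) * (h k z + Cconj (g k z)))
    (fun k => RtoC (Cmod z ^ (2 * (k - 1)))
              * (euler (a k) z + Cconj (RtoC (-1) * euler (b k) z)))).
  intros k Hk. destruct (H k Hk) as [Hh Hg].
  apply (has_angular_radial (fun z => h k z + Cconj (g k z))).
  apply has_angular_plus.
  - destruct (has_expansion_cderiv _ _ _ z Hh (has_expansion_euler _ _ Hh) Hz) as (l & <- & Hl).
    now apply has_cderiv_angular.
  - destruct (has_expansion_cderiv _ _ _ z Hg (has_expansion_euler _ _ Hg) Hz) as (l & <- & Hl).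
    replace (Cconj (RtoC (-1) * (z * l))) with (- Cconj (z * l))
      by (apply injective_projections; simpl; ring).
    now apply has_angular_conj, has_cderiv_angular.
Qed.

Lemma sum_n_m_linear (u v : nat -> C) (A B : C) (m n : nat) :
  A * sum_n_m u m n + B * sum_n_m v m n
  = sum_n_m (G := C_AbelianMonoid) (fun k => A * u k + B * v k) m n.
Proof.
  rewrite <- (sum_n_m_mult_l (K := C_Ring) A u), <- (sum_n_m_mult_l (K := C_Ring) B v).
  symmetry. apply (sum_n_m_plus (G := C_AbelianMonoid)).
Qed.

(** Both kernels have slope (1 + xi) / D. The minus sign before [conv_bar] matches the one with
    which the co-analytic parts enter L, and it turns the opposite constant terms -c and c into the
    common factor -c of F. *)
Lemma convolution_sum (p : nat) (alpha : R) (a b : nat -> nat -> C)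
    (h g : nat -> C -> C) (F : C -> C) (z xi : C) :
  (0 <= alpha < 1)%R -> Cmod xi = 1%R ->
  (forall k, (1 <= k <= p)%nat -> a k O = 0 /\ b k O = 0 /\
     has_expansion (fun z => z) (h k) (a k) /\ has_expansion (fun z => z) (g k) (b k)) ->
  (forall z, unit_disc z -> F z = polyh_sum p h g z) ->
  unit_disc z ->
  sum_n_m (fun k : nat => RtoC (Cmod z ^ (2 * (k - 1)))
      * (conv (h k)
           (fun w => (w + (alpha * xi + alpha + xi - 1)
                            / (2 - alpha - alpha * xi) * w ^ 2)
                     / (1 - w) ^ 2) z
         - conv_bar (fun w => Cconj (g k w))
           (fun w => ((2 * xi + alpha + alpha * xi)
                        / (2 - alpha - alpha * xi) * Cconj w
                      - (alpha * xi + alpha + xi - 1)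
                        / (2 - alpha - alpha * xi) * Cconj w ^ 2)
                     / (1 - Cconj w) ^ 2) z)) 1 p
  = ((1 + xi) * angular F z - (alpha * xi + alpha + xi - 1) * F z)
    / (2 - alpha - alpha * xi).
Proof.
  intros Ha Hxi H HF Hz. pose proof (circle_denominator_neq_0 alpha xi Ha Hxi) as HD.
  set (D := 2 - alpha - alpha * xi) in *. set (c := (alpha * xi + alpha + xi - 1) / D).
  rewrite (angular_polyh_sum p a b h g F z), HF; [|exact Hz| |exact HF|exact Hz].
  2: { intros k Hk. now destruct (H k Hk) as (_ & _ & ? & ?). }
  unfold polyh_sum.
  set (SL := sum_n_m (fun k => _ * (euler (a k) z + _)) 1 p).
  set (SF := sum_n_m (fun k => _ * (h k z + _)) 1 p).
  replace (((1 + xi) * SL - (alpha * xi + alpha + xi - 1) * SF) / D)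
    with ((1 + xi) / D * SL + - c * SF) by (unfold c; field; exact HD).
  unfold SL, SF. rewrite sum_n_m_linear.
  apply sum_n_m_ext_loc. intros k Hk.
  destruct (H k Hk) as (Ha0 & Hb0 & Hh & Hg).
  unfold conv, conv_bar.
  (* Here A + B = 1, the coefficient of z in the first kernel, because 1 + xi - (alpha xi + alpha +
     xi - 1) = D. *)
  rewrite (hadamard_kernel (fun z => z) (h k) (euler (a k)) _ (a k) ((1 + xi) / D) (- c) z);
    try assumption; [|reflexivity|reflexivity|now apply (has_expansion_euler (h k))|].
  2: { intros w. apply (f_equal (fun q => q / (1 - w) ^ 2)). unfold c, D; field; exact HD. }
  (* Here A + B = (2 xi + alpha + alpha xi) / D, the linear coefficient of the second kernel. *)
  rewrite (hadamard_kernel Cconj (fun z => Cconj (g k z)) (fun z => Cconj (euler (b k) z)) _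
             (fun n => Cconj (b k n)) ((1 + xi) / D) c z).
  - rewrite Cmult_conj. replace (Cconj (RtoC (-1))) with (RtoC (-1))
      by (apply injective_projections; simpl; ring).
    change (RtoC (-1)) with (RtoC (- (1))). rewrite RtoC_opp.
    match goal with |- ?l = ?r => change (@eq C l r) end. ring.
  - intros x. apply injective_projections; simpl; ring.
  - apply Cmod_conj.
  - rewrite Hb0. apply injective_projections; simpl; ring.
  - now apply has_expansion_conj.
  - intros w Hw. apply is_pseries_C.
    pose proof (has_expansion_conj _ _ (has_expansion_euler _ _ Hg) w Hw) as K.
    apply is_pseries_C in K. revert K. apply is_Cseries_ext. intros n.
    rewrite Cmult_conj. f_equal. f_equal. apply injective_projections; simpl; ring.
  - intros w. apply (f_equal (fun q => q / (1 - Cconj w) ^ 2)). unfold c, D; field; exact HD.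
  - exact Hz.
Qed.

Theorem theorem2 (p : nat) (alpha : R) (a b : nat -> nat -> C)
    (h g : nat -> C -> C) (F : C -> C)
    (hp : (1 <= p)%nat) (halpha : (0 <= alpha < 1)%R)
    (hF : in_H0 p a b h g F) (hU : univalent F) :
  starlike p alpha F <->
  forall z xi : C, unit_disc z -> z <> 0 -> Cmod xi = 1%R ->
    sum_n_m (fun k : nat => RtoC (Cmod z ^ (2 * (k - 1)))
      * (conv (h k)
           (fun w => (w + (alpha * xi + alpha + xi - 1)
                            / (2 - alpha - alpha * xi) * w ^ 2)
                     / (1 - w) ^ 2) z
         - conv_bar (fun w => Cconj (g k w))
           (fun w => ((2 * xi + alpha + alpha * xi)
                        / (2 - alpha - alpha * xi) * Cconj w
                      - (alpha * xi + alpha + xi - 1)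
                        / (2 - alpha - alpha * xi) * Cconj w ^ 2)
                     / (1 - Cconj w) ^ 2) z)) 1 p
    <> RtoC 0.
Proof.
  destruct hF as [(Hpoly & Hhg & HF & Ha1 & _) [Hb1 Hk1]].
  change (forall z, unit_disc z -> F z = polyh_sum p h g z) in HF.
  assert (Hexp : forall k, (1 <= k <= p)%nat ->
    has_expansion (fun z => z) (h k) (a k) /\ has_expansion (fun z => z) (g k) (b k)).
  { intros k Hk. now destruct (Hhg k Hk) as (_ & _ & ? & ?). }
  destruct (polyh_sum_tangent p a b h g hp Hhg Ha1 Hb1 Hk1) as [M HM].
  assert (HMF : forall w, (Cmod w <= / 2)%R ->
    (Cmod (F w - w) <= M * (Cmod w * Cmod w))%R).
  { intros w Hw. rewrite HF by (unfold unit_disc; lra). now apply HM. }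
  assert (HML : exists M', forall w, (Cmod w <= / 2)%R ->
    (Cmod (angular F w - w) <= M' * (Cmod w * Cmod w))%R).
  { destruct (polyh_sum_tangent p (fun k n => INR n * a k n)
      (fun k n => RtoC (-1) * (INR n * b k n)) (fun k => euler (a k))
      (fun k z => RtoC (-1) * euler (b k) z)) as [M' HM'].
    - exact hp.
    - intros k Hk. destruct (Hhg k Hk) as (_ & _ & Hh & Hg). simpl INR.
      split; [ring|]. split; [ring|]. split; [now apply (has_expansion_euler (h k))|].
      now apply has_expansion_scal, (has_expansion_euler (g k)).
    - rewrite Ha1. simpl. ring.
    - rewrite Hb1. simpl. ring.
    - intros k Hk. destruct (Hk1 k Hk) as [-> ->]. split; ring.
    - exists M'. intros w Hw. assert (unit_disc w) by (unfold unit_disc; lra).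
      rewrite (angular_polyh_sum p a b h g F w) by assumption. now apply HM'. }
  destruct HML as [M' HML].
  assert (Hd0 : unit_disc 0) by (unfold unit_disc; rewrite Cmod_0; lra).
  assert (HF0 : F 0 = 0).
  { pose proof (HMF 0) as H0. rewrite Cmod_0 in H0.
    replace (F 0) with (F 0 - 0) by ring. apply Cmod_eq_0, Rle_antisym; [|apply Cmod_ge_0].
    eapply Rle_trans; [apply H0; lra|right; ring]. }
  assert (HFn0 : forall z, unit_disc z -> z <> 0 -> F z <> 0).
  { intros z Hz Hz0 E. apply Hz0, hU; [exact Hz|exact Hd0|]. now rewrite HF0. }
  split.
  - intros (_ & _ & _ & Hstar) z xi Hz Hz0 Hxi.
    rewrite (convolution_sum p alpha a b h g F) by assumption. intros E.
    specialize (Hstar z Hz Hz0). fold (angular F z) in Hstar.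
    pose proof (circle_denominator_neq_0 alpha xi halpha Hxi) as HD.
    assert (E' : (1 + xi) * angular F z = (alpha * xi + alpha + xi - 1) * F z).
    { set (l := (1 + xi) * angular F z) in *. set (r := _ * F z) in *.
      replace l with ((l - r) / (2 - alpha - alpha * xi) * (2 - alpha - alpha * xi) + r)
        by (field; exact HD).
      rewrite E. ring. }
    apply circle_condition_vanish in E'; [|exact Hxi].
    change (excess alpha F z = 0%R) in E'.
    rewrite excess_quotient in E' by now apply HFn0.
    pose proof (proj1 (Cmod_gt_0 _) (HFn0 z Hz Hz0)) as Hpos.
    assert (0 < Cmod (F z) ^ 2)%R by now apply pow_lt.
    nra.
  - intros Hne. split; [exact hU|]. split; [exact Hpoly|]. split; [exact HF0|].
    intros z Hz Hz0. fold (angular F z).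
    apply Rnot_le_lt. intros Hle.
    (* Since p is at least 1, the order 2p is a successor, which yields the continuous first partial
       derivatives needed along rays. *)
    destruct Hpoly as [HC _]. destruct (2 * p)%nat as [|n] eqn:En; [lia|].
    destruct (excess_zero_exists n alpha M M' F z halpha HC HMF HML Hz Hz0)
      as (w & Hw & Hw0 & Ew).
    { rewrite excess_quotient by now apply HFn0.
      pose proof (pow2_ge_0 (Cmod (F z))). nra. }
    destruct (circle_condition_exists alpha (angular F w) (F w) (HFn0 w Hw Hw0) Ew)
      as (xi & Hxi & Exi).
    apply (Hne w xi Hw Hw0 Hxi).
    rewrite (convolution_sum p alpha a b h g F) by assumption.
    rewrite Exi.
    apply (eq_trans (y := 0 / (2 - alpha - alpha * xi))); [f_equal|unfold Cdiv]; ring.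
Qed.
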